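(* Let $\varepsilon_{1}, \varepsilon_{2}\geq 0$, $\kappa\in\mathbb{R}$, $n, m\in\mathbb{Z}\setminus\{0\}$, $n\neq m$, and assume that the function $f:\mathbb{R}\rightarrow\mathbb{R}$ fulfills the inequalities \[ \left|f(x+y)-f(x)-f(y)\right|\leq \varepsilon_{1}\quad\text{for all } x,y\in\mathbb{R} \] and \[ \left|f(x^{n})-\kappa x^{n-m}f(x^{m})\right|\leq \varepsilon_{2}\quad\text{for all } x\in\mathbb{R}\setminus\{0\}. \] Then there exist a derivation $F:\mathbb{R}\rightarrow\mathbb{R}$ and $\lambda\in\mathbb{R}$ such that \[ (n-\kappa m)F(x)=0 \quad\text{and}\quad \left|f(x)-\left[F(x)+\lambda x\right]\right|\leq \varepsilon_{1} \] are satisfied for all $x\in\mathbb{R}$.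
   Context: A function $f:\mathbb{R}\rightarrow\mathbb{R}$ is additive if $f(x+y)=f(x)+f(y)$ for all $x,y\in\mathbb{R}$. An additive function $f:\mathbb{R}\rightarrow\mathbb{R}$ is a derivation if $f(xy)=xf(y)+yf(x)$ for all $x,y\in\mathbb{R}$. *)

(* Defs.v *)
From mathcomp Require Import all_boot all_order all_algebra.
From mathcomp Require Import reals.

Set Implicit Arguments.
Unset Strict Implicit.
Unset Printing Implicit Defensive.

Import Order.TTheory GRing.Theory Num.Theory.
Local Open Scope ring_scope.

Definition additive_fun (R : realType) (f : R -> R) : Prop :=
  forall x y : R, f (x + y) = f x + f y.

(* Neither linearity over R nor continuity is assumed, so these are not the
   (linear) derivations of mathcomp.field.separable. *)
Definition derivation (R : realType) (f : R -> R) : Prop :=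
  additive_fun f /\ forall x y : R, f (x * y) = x * f y + y * f x.

(* Main.v *)
Require Import Defs.
From mathcomp Require Import all_boot all_order all_algebra.
From mathcomp Require Import classical_sets reals ring lra.

Set Implicit Arguments.
Unset Strict Implicit.
Unset Printing Implicit Defensive.

Import Order.TTheory GRing.Theory Num.Theory.
Local Open Scope ring_scope.

(** By Hyers' theorem [f] lies within [eps1] of an additive function [A], and
    everything is read off the slope [a x = A x / x].  The slope is invariant
    under nonzero rational dilations, so every expression built from slopes of
    powers of [x] is bounded on the nonzero reals as soon as it is bounded on
    the annulus [1 <= |x| <= 2].  On that annulus the second inequality for [f]
    survives replacing [f] by [A], whence
      [a (x ^ n) = kappa * a (x ^ m) + O(1)]   for all nonzero [x].
    This relation is stable under [A x |-> A x - A 1 * x], which shifts [a] by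
    a constant; hence assume [A 1 = 0] and show that [A] is a derivation.

    An additive function with bounded slope is linear
    ([additive_bounded_linear]).  Applied to the biadditive defect
    [A (x y) - x A y - y A x], which polarizes [A (x^2) - 2 x A x], this shows
    that [a (x^2) = 2 a x + O(1)] already forces [A] to be a derivation
    ([derivation_of_square]).  The relation above is brought to that form
    as follows ([derivation_of_power_relation]).
    - If [kappa = 0], then [a] is bounded, since [|y|] has a real [n]-th root.
    - If [m = - n], the same roots give [a (1/y) = kappa * a y + O(1)], and the
      partial fractions of [1 / (x (x + 3))] express [A (x^2)] by [A x]
      ([derivation_of_inversion]).
    - Otherwise, using the relation at [x ^ n] and at [x ^ m] gives
      [a (x ^ n^2) = kappa^2 * a (x ^ m^2) + O(1)], with distinct positive
      exponents.  Replacing [x] by [1 + s x] for natural numbers [s] turns this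
      into a bound on the values of a polynomial in [s], hence on its
      coefficients; those of [s] and [s^2] give the conclusion
      ([derivation_of_lt_exponents]).

    Finally a derivation satisfies [a (x ^ k) = k * a x], so the relation says
    that [(n - kappa m) a] is bounded; then [(n - kappa m) A] is linear and
    vanishes at 1, so it is zero. *)

(** * Additive approximation of an approximately additive function *)

Lemma approx_additiveMn (R : realType) (f : R -> R) (e : R) :
  (forall x y, `|f (x + y) - f x - f y| <= e) ->
  forall k x, `|f (x *+ k.+1) - f x *+ k.+1| <= e *+ k.
Proof.
move=> fe k x; elim: k => [|k IHk]; first by rewrite subrr normr0.
rewrite [x *+ _]mulrS [f x *+ _]mulrS [e *+ _]mulrS.
have := fe x (x *+ k.+1).
by move: IHk; rewrite !ler_norml => /andP[? ?] /andP[? ?]; apply/andP; split; lra.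
Qed.

(** Hyers' theorem.  The intervals of radius [e / k] around [f (k x) / k],
    [k >= 1], meet pairwise, because [f (j k x)] is comparable both to
    [j f (k x)] and to [k f (j x)].  Hence the supremum [A x] of their left ends
    lies in all of them: [k A x] stays within [e] of [f (k x)] for every [k].
    This determines [A x], and it makes [A] additive because [k] times its
    additivity defect stays bounded. *)
Lemma hyers (R : realType) (f : R -> R) (e : R) :
  (forall x y, `|f (x + y) - f x - f y| <= e) ->
  exists A : R -> R, additive_fun A /\ forall x, `|f x - A x| <= e.
Proof.
move=> fe; have e0 : 0 <= e by apply: le_trans (fe 0 0).
pose lower x :=
  [set y | exists k : nat, y = (f (x *+ k.+1) - e) / k.+1%:R]%classic.
pose A x := sup (lower x).
have cross x (j k : nat) :
    (f (x *+ j.+1) - e) / j.+1%:R <= (f (x *+ k.+1) + e) / k.+1%:R.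
  rewrite ler_pdivrMr ?ltr0n// mulrAC ler_pdivlMr ?ltr0n//.
  have := approx_additiveMn fe k (x *+ j.+1).
  have := approx_additiveMn fe j (x *+ k.+1).
  rewrite -!mulrnA [(k.+1 * j.+1)%N]mulnC !ler_norml !mulr_natr.
  rewrite !mulrnDl !mulNrn ![e *+ _.+1]mulrS.
  by move=> /andP[? ?] /andP[? ?]; lra.
have AP x k : `|f (x *+ k.+1) - A x *+ k.+1| <= e.
  have ubA j : ubound (lower x) ((f (x *+ j.+1) + e) / j.+1%:R).
    by move=> _ [i ->]; exact: cross.
  have le1 : (f (x *+ k.+1) - e) / k.+1%:R <= A x.
    apply: ub_le_sup; last by exists k.
    by exists ((f (x *+ 1) + e) / 1%:R).
  have le2 : A x <= (f (x *+ k.+1) + e) / k.+1%:R.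
    by apply: ge_sup => //; exists ((f (x *+ 1) - e) / 1%:R); exists 0%N.
  move: le1 le2; rewrite ler_pdivrMr ?ltr0n// ler_pdivlMr ?ltr0n// !mulr_natr.
  by rewrite ler_norml => ? ?; apply/andP; split; lra.
exists A; split; last by move=> x; have := AP x 0%N.
move=> x y; apply/eqP; rewrite -subr_eq0 -normr_le0 -[X in X <= _]mulr1.
set d := A (x + y) - _.
have dk k : `|d| *+ k.+1 <= e *+ 4.
  have := AP (x + y) k; have := AP x k; have := AP y k.
  have := fe (x *+ k.+1) (y *+ k.+1); rewrite -mulrnDl.
  rewrite -normrMn /d mulrnBl mulrnDl !ler_norml => /andP[? ?] /andP[? ?].
  by move=> /andP[? ?] /andP[? ?]; apply/andP; split; lra.
rewrite mulr1 leNgt; apply/negP => d0.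
have := archi_boundP (_ : 0 <= e *+ 4 / `|d|).
rewrite divr_ge0 ?mulrn_wge0// => /(_ isT).
rewrite ltr_pdivrMr// mulr_natl; apply/negP; rewrite -leNgt.
apply: le_trans (dk (Num.bound (e *+ 4 / `|d|))).
by rewrite ler_pMn2l.
Qed.

(** * Slopes of additive functions *)

Lemma additive_fun0 (R : realType) (A : R -> R) : additive_fun A -> A 0 = 0.
Proof. by move=> Aadd; have := Aadd 0 0; rewrite addr0 => ?; lra. Qed.

Lemma additive_funN (R : realType) (A : R -> R) x :
  additive_fun A -> A (- x) = - A x.
Proof.
by move=> Aadd; have := Aadd x (- x); rewrite subrr additive_fun0// => ?; lra.
Qed.

Lemma additive_funMn (R : realType) (A : R -> R) k x :
  additive_fun A -> A (x *+ k) = A x *+ k.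
Proof.
move=> Aadd; elim: k => [|k IHk]; first by rewrite !mulr0n additive_fun0.
by rewrite !mulrS Aadd IHk.
Qed.

Lemma additive_funMz (R : realType) (A : R -> R) (k : int) x :
  additive_fun A -> A (k%:~R * x) = k%:~R * A x.
Proof.
move=> Aadd; rewrite !mulrzl; case: k => k; first exact: additive_funMn.
by rewrite NegzE !mulrNz additive_funN// -!pmulrn additive_funMn.
Qed.

Lemma additive_funZ_rat (R : realType) (A : R -> R) (q : rat) x :
  additive_fun A -> A (ratr q * x) = ratr q * A x.
Proof.
move=> Aadd; have d0 : (denq q)%:~R != 0 :> R by rewrite intr_eq0 denq_neq0.
apply: (mulfI d0); rewrite -additive_funMz//.
have -> : (denq q)%:~R * (ratr q * x) = (numq q)%:~R * x.
  by rewrite /ratr; field.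
by rewrite additive_funMz// /ratr; field.
Qed.

Definition slope (R : realType) (A : R -> R) (x : R) : R := A x / x.

Lemma slope_homogeneous (R : realType) (A : R -> R) (q : rat) x :
  additive_fun A -> q != 0 -> slope A (ratr q * x) = slope A x.
Proof.
move=> Aadd q0; rewrite /slope additive_funZ_rat//.
by rewrite -mulf_div divff ?mul1r// fmorph_eq0.
Qed.

Lemma slope_norm (R : realType) (A : R -> R) x :
  additive_fun A -> slope A `|x| = slope A x.
Proof.
move=> Aadd; case: (ler0P x) => [_|//].
by rewrite /slope additive_funN// invrN mulrNN.
Qed.

Definition bounded_off0 (R : realType) (g : R -> R) : Prop :=
  exists C : R, forall x : R, x != 0 -> `|g x| <= C.

Definition bounded_annulus (R : realType) (g : R -> R) : Prop :=
  exists C : R, forall x : R, 1 <= `|x| <= 2 -> `|g x| <= C.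

(** Every nonzero real is moved into the annulus by a rational dilation. *)
Lemma homogeneous_bounded (R : realType) (g : R -> R) :
  (forall (q : rat) x, q != 0 -> g (ratr q * x) = g x) ->
  bounded_annulus g -> bounded_off0 g.
Proof.
move=> ghom [C gC]; exists C => x x0.
have x_gt0 : 0 < `|x| by rewrite normr_gt0.
have /rat_in_itvoo[q] : `|x|^-1 < 2 * `|x|^-1.
  by rewrite ltr_pMl ?invr_gt0// ltr1n.
rewrite in_itv/= => /andP[q1 q2].
have {}q1 : 1 < ratr q * `|x| by rewrite -ltr_pdivrMr// div1r.
have {}q2 : ratr q * `|x| < 2 by rewrite -ltr_pdivlMr.
have q_gt0 : 0 < ratr q :> R by rewrite -(pmulr_lgt0 _ x_gt0) (lt_trans _ q1).
rewrite -(ghom q); last by rewrite -(fmorph_eq0 (@ratr R)) gt_eqF.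
by apply: gC; rewrite normrM (gtr0_norm q_gt0) !ltW.
Qed.

(** The difference [B] of [A] and its candidate linear form vanishes on the
    rationals and satisfies [|B x| <= K |x|] everywhere, so
    [|B x| = |B (x - q)| <= K |x - q|] for rationals [q] close to [x]. *)
Lemma additive_bounded_linear (R : realType) (A : R -> R) :
  additive_fun A -> bounded_annulus A -> forall x, A x = A 1 * x.
Proof.
move=> Aadd [C AC] x.
pose B y := A y - A 1 * y.
have Badd : additive_fun B by move=> y z; rewrite /B Aadd; ring.
have [K BK] : bounded_off0 (slope B).
  apply: homogeneous_bounded => [q y|]; first exact: slope_homogeneous.
  exists (C + `|A 1| * 2) => y y12; case/andP: (y12) => y1 y2.
  rewrite /slope normrM normfV ler_pdivrMr ?(lt_le_trans ltr01)//.
  have C0 : 0 <= C + `|A 1| * 2.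
    by rewrite addr_ge0 ?mulr_ge0// (le_trans _ (AC _ y12)).
  apply: le_trans (_ : C + `|A 1| * 2 <= _); last by rewrite ler_peMr.
  rewrite (le_trans (ler_normB _ _))// lerD ?AC// normrM.
  by rewrite ler_wpM2l.
have BKx y : `|B y| <= (`|K| + 1) * `|y|.
  have [->|y0] := eqVneq y 0; first by rewrite additive_fun0// normr0 mulr0.
  have := BK _ y0; rewrite /slope normrM normfV ler_pdivrMr ?normr_gt0// => h.
  by rewrite (le_trans h)// ler_wpM2r// (le_trans (ler_norm _))// lerDl.
have Bq (q : rat) : B (ratr q) = 0.
  by rewrite -[ratr q]mulr1 additive_funZ_rat// /B; ring.
suff /normr0_eq0 : `|B x| = 0 by rewrite /B; move/eqP; rewrite subr_eq0 => /eqP.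
apply/eqP; rewrite eq_le normr_ge0 andbT; apply/ler_addgt0Pr => e e0.
have K0 : 0 < `|K| + 1 by rewrite ltr_wpDl.
have /rat_in_itvoo[q] : x - e / (`|K| + 1) < x by rewrite gtrBl divr_gt0.
rewrite in_itv/= => /andP[q1 q2]; rewrite add0r.
have -> : B x = B (x - ratr q) by rewrite Badd additive_funN// Bq; ring.
rewrite (le_trans (BKx _))// mulrC -ler_pdivlMr// gtr0_norm ?subr_gt0//.
by rewrite lerBlDl -lerBlDr ltW.
Qed.

(** * Derivations *)

(** With [D z = A (z^2) - 2 z A z], polarization writes twice the defect
    [A (x y) - x A y - y A x] as [D (x + y) - D x - D y].  Since [D z / z^2] is
    invariant under rational dilations, [D] is quadratically bounded; so for
    fixed [x] the defect is an additive, locally bounded function of [y].  It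
    is therefore linear in [y], and it vanishes at [y = 1]. *)
Lemma derivation_of_square (R : realType) (A : R -> R) :
  additive_fun A -> A 1 = 0 ->
  bounded_annulus (fun x => A (x ^+ 2) - 2 * x * A x) -> derivation A.
Proof.
move=> Aadd A1 [C AC]; split=> // x y.
pose D z := A (z ^+ 2) - 2 * z * A z.
have [K DK] : bounded_off0 (fun z => D z / z ^+ 2).
  apply: homogeneous_bounded => [q z q0|].
    have [->|z0] := eqVneq z 0; first by rewrite mulr0.
    have q0' : ratr q != 0 :> R by rewrite fmorph_eq0.
    have q2 : ratr q ^+ 2 = ratr (q ^+ 2) :> R by rewrite rmorphXn.
    rewrite /D exprMn q2 !(additive_funZ_rat _ _ Aadd) -q2.
    by field; rewrite q0' z0.
  exists C => z z12; case/andP: (z12) => z1 _.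
  have z2 : 1 <= `|z ^+ 2| by rewrite normrX exprn_ege1.
  rewrite normrM normfV ler_pdivrMr ?(lt_le_trans ltr01)//.
  have DzC := AC _ z12.
  by rewrite (le_trans DzC)// ler_peMr// (le_trans _ DzC).
have DKx z : `|D z| <= `|K| * `|z| ^+ 2.
  have [->|z0] := eqVneq z 0.
    by rewrite /D expr0n/= additive_fun0// !(mulr0, subr0, normr0, expr0n).
  have := DK _ z0; rewrite normrM normfV normrX.
  rewrite ler_pdivrMr ?exprn_gt0 ?normr_gt0// => /le_trans; apply.
  by rewrite ler_wpM2r ?exprn_ge0// ler_norm.
pose B z := A (x * z) - x * A z - z * A x.
suff : B y = 0 by rewrite /B => ?; lra.
have Badd : additive_fun B by move=> u v; rewrite /B mulrDr !Aadd; ring.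
rewrite (additive_bounded_linear Badd); first by rewrite /B mulr1 A1; ring.
exists (`|K| * ((`|x| + 2) ^+ 2 + `|x| ^+ 2 + 2 ^+ 2)) => z /andP[_ z2].
have BD : 2 * B z = D (x + z) - D x - D z.
  by rewrite /B /D sqrrD !Aadd; ring.
have B2 : `|B z| <= `|2 * B z| by rewrite normrM ger0_norm// ler_peMl// ler1n.
rewrite (le_trans B2)// BD.
apply: le_trans (_ : `|D (x + z)| + `|D x| + `|D z| <= _).
  by rewrite (le_trans (ler_normB _ _))// lerD2r ler_normB.
rewrite !mulrDr !lerD ?(le_trans (DKx _))// ler_wpM2l// lerXn2r ?nnegrE//.
  by rewrite addr_ge0.
by rewrite (le_trans (ler_normD _ _))// lerD2l.
Qed.

Lemma derivation_of_bounded (R : realType) (A : R -> R) :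
  additive_fun A -> A 1 = 0 -> bounded_annulus A -> derivation A.
Proof.
move=> Aadd A1 /(additive_bounded_linear Aadd) Alin; split=> // x y.
by rewrite (Alin (x * y)) (Alin x) (Alin y) A1; ring.
Qed.

Lemma derivation1 (R : realType) (F : R -> R) : derivation F -> F 1 = 0.
Proof. by move=> [_ /(_ 1 1)]; rewrite !mul1r => ?; lra. Qed.

Lemma derivation_slopeM (R : realType) (F : R -> R) x y :
  derivation F -> x != 0 -> y != 0 ->
  slope F (x * y) = slope F x + slope F y.
Proof. by move=> [_ FM] x0 y0; rewrite /slope FM; field; rewrite x0 y0. Qed.

Lemma derivation_slope_exprz (R : realType) (F : R -> R) (k : int) x :
  derivation F -> x != 0 -> slope F (x ^ k) = k%:~R * slope F x.
Proof.
move=> Fder x0.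
have F1 : slope F 1 = 0 by rewrite /slope derivation1// mul0r.
have natP (j : nat) : slope F (x ^+ j) = j%:R * slope F x.
  elim: j => [|j IHj]; first by rewrite expr0 F1 mul0r.
  rewrite exprS derivation_slopeM ?expf_neq0// IHj -natr1; ring.
case: k => k; first exact: natP.
rewrite NegzE -exprnN intrN mulNr -pmulrn -natP; apply/eqP.
rewrite -addr_eq0 addrC -derivation_slopeM ?invr_eq0 ?expf_neq0//.
by rewrite mulfV ?F1 ?expf_neq0.
Qed.

(** * Relations between positive powers *)

(** The coefficients are the images of the values at [0, ..., d - 1] under the
    inverse of a Vandermonde matrix. *)
Lemma interpolation_bound (R : realFieldType) (d : nat) :
  exists K : R, forall (p : {poly R}) (M : R), (size p <= d)%N ->
    (forall j, (j < d)%N -> `|p.[j%:R]| <= M) ->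
    forall i, (i < d)%N -> `|p`_i| <= K * M.
Proof.
pose V : 'M[R]_d := Vandermonde d (\row_j j%:R).
have Vu : V \in unitmx.
  rewrite unitmxE unitfE det_Vandermonde; apply/prodf_neq0 => i _.
  apply/prodf_neq0 => j ij; rewrite !mxE subr_eq0 eqr_nat.
  by rewrite gtn_eqF.
exists (\sum_i \sum_j `|invmx V j i|) => p M sp pM i id.
pose c : 'rV[R]_d := \row_j p`_j; pose v : 'rV[R]_d := \row_j p.[j%:R].
have vE : v = c *m V.
  apply/rowP => j; rewrite !mxE (horner_coef_wide _ sp).
  by apply: eq_bigr => k _; rewrite !mxE.
have -> : p`_i = \sum_j v 0 j * invmx V j (Ordinal id).
  have : c = v *m invmx V by rewrite vE mulmxK.
  by move=> /rowP/(_ (Ordinal id)); rewrite !mxE.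
have M0 : 0 <= M by apply: le_trans (pM i id).
rewrite [in leRHS](bigD1 (Ordinal id))//= mulrDl -[leLHS]addr0 lerD//; last first.
  by rewrite mulr_ge0// !sumr_ge0// => *; rewrite sumr_ge0.
rewrite (le_trans (ler_norm_sum _ _ _))// mulr_suml ler_sum// => j _.
by rewrite normrM mulrC ler_wpM2l// mxE pM.
Qed.

(** Natural evaluation points are enough for an additive [A] to commute with
    evaluation, as [A] commutes with multiplication by natural numbers. *)
Lemma horner_map_additive (R : realType) (A : R -> R) (p : {poly R}) k :
  additive_fun A -> (map_poly A p).[k%:R] = A p.[k%:R].
Proof.
move=> Aadd; rewrite (horner_coef_wide _ (size_poly _ _)) horner_coef.
rewrite (big_morph A Aadd (additive_fun0 Aadd)); apply: eq_bigr => i _.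
rewrite coef_map_id0 ?additive_fun0// -natrX !mulr_natr.
by rewrite (additive_funMn _ _ Aadd).
Qed.

Lemma coef_affineX (R : realType) (x : R) n k :
  ((1 + x *: 'X : {poly R}) ^+ n)`_k = 'C(n, k)%:R * x ^+ k.
Proof.
rewrite exprDn coef_sum.
have E (i : nat) : ((1 ^+ (n - i) * (x *: 'X) ^+ i *+ 'C(n, i)) : {poly R})`_k
    = if i == k then 'C(n, k)%:R * x ^+ k else 0.
  rewrite expr1n mul1r exprZn coefMn coefZ coefXn eq_sym.
  by case: eqP => [->|_]; rewrite ?mulr0 ?mul0rn// mulr1 mulr_natl.
under eq_bigr do rewrite E.
have [kn|kn] := leqP k n.
  rewrite (bigD1 (Ordinal (kn : k < n.+1)%N))//= eqxx big1 ?addr0// => i ik.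
  by rewrite ifN//; apply: contraNneq ik => ik; apply/eqP/val_inj.
rewrite bin_small// mul0r big1// => i _; rewrite ifN//.
by apply: contraTneq (ltn_ord i) => ->; rewrite -leqNgt.
Qed.

(** For fixed [x] in the annulus, the value of
    [E y = A (y^n) - kappa y^(n-m) A (y^m)] at [y = 1 + s x] is a polynomial
    [P x] in [s], bounded for [s = 0, ..., n], so its coefficients are bounded
    independently of [x].  The coefficient of [s] is [(n - kappa m) A x]: if
    [n <> kappa m] then [A] is bounded on the annulus.  If [n = kappa m], the
    coefficient of [s^2] is [n (n - m) / 2 * (A (x^2) - 2 x A x)]. *)
Lemma derivation_of_lt_exponents (R : realType) (A : R -> R) (kappa : R)
    (n m : nat) :
  additive_fun A -> A 1 = 0 -> (0 < m < n)%N ->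
  bounded_off0 (fun x => slope A (x ^+ n) - kappa * slope A (x ^+ m)) ->
  derivation A.
Proof.
move=> Aadd A1 /andP[m0 mn] [C AC].
have A0 := additive_fun0 Aadd.
have n0 : (0 < n)%N by apply: leq_trans mn.
pose E y := A (y ^+ n) - kappa * (y ^+ (n - m) * A (y ^+ m)).
have EC y : `|E y| <= `|C| * `|y| ^+ n.
  have [->|y0] := eqVneq y 0.
    by rewrite /E normr0 !expr0n !eqn0Ngt n0 m0 A0 !(mulr0, subr0) normr0.
  have -> : E y = (slope A (y ^+ n) - kappa * slope A (y ^+ m)) * y ^+ n.
    rewrite /E /slope; move: (A _) (A _) => a b.
    rewrite -[n in RHS](subnK (ltnW mn)) exprD.
    by field; rewrite !expf_neq0.
  by rewrite normrM normrX ler_wpM2r ?exprn_ge0// (le_trans (AC _ y0))// ler_norm.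
pose L x : {poly R} := 1 + x *: 'X.
pose P x := map_poly A (L x ^+ n) -
  kappa *: (L x ^+ (n - m) * map_poly A (L x ^+ m)).
have sL x k : (size (L x ^+ k) <= k.+1)%N.
  rewrite (leq_trans (size_poly_exp_leq _ _))// ltnS -[leqRHS]mul1n leq_mul2r.
  apply/orP; right; rewrite -subn1 leq_subLR (leq_trans (size_polyD _ _))//.
  by rewrite size_poly1 geq_max/= (leq_trans (size_scale_leq _ _))// size_polyX.
have sP x : (size (P x) <= n.+1)%N.
  rewrite (leq_trans (size_polyD _ _))// geq_max (leq_trans (size_poly _ _))//=.
  rewrite size_polyN (leq_trans (size_scale_leq _ _))//.
  rewrite (leq_trans (size_polyMleq _ _))// -subn1 leq_subLR.
  rewrite (leq_trans (leq_add (sL _ _) (leq_trans (size_poly _ _) (sL _ _))))//.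
  by rewrite addSn addnS subnK// ltnW.
have PE x (j : nat) : (P x).[j%:R] = E (1 + x * j%:R).
  by rewrite /P /E !hornerE !horner_map_additive// !hornerE.
have [K PK] := interpolation_bound R n.+1.
pose M := `|C| * (1 + 2 * n%:R) ^+ n.
have Pb x i : 1 <= `|x| <= 2 -> (i <= n)%N -> `|(P x)`_i| <= K * M.
  case/andP=> _ x2 ni; apply: (PK (P x) M (sP x)) => // j jn.
  rewrite PE (le_trans (EC _))// ler_wpM2l// lerXn2r ?nnegrE ?addr_ge0 ?mulr_ge0//.
  rewrite (le_trans (ler_normD _ _))// normr1 lerD2l normrM normr_nat.
  by rewrite ler_pM// ler_nat -ltnS.
have c0 x k : (map_poly A (L x ^+ k))`_0 = 0.
  by rewrite coef_map_id0// coef_affineX bin0 mul1r.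
have c1 x k : (map_poly A (L x ^+ k))`_1 = k%:R * A x.
  by rewrite coef_map_id0// coef_affineX bin1 expr1 !mulr_natl additive_funMn.
have c2 x k : (map_poly A (L x ^+ k))`_2 = 'C(k, 2)%:R * A (x ^+ 2).
  by rewrite coef_map_id0// coef_affineX !mulr_natl additive_funMn.
have P1 x : (P x)`_1 = (n%:R - kappa * m%:R) * A x.
  rewrite coefB coefZ coefM !big_ord_recr big_ord0/= !c0 !c1.
  by rewrite coef_affineX bin0; ring.
have P2 x : (P x)`_2 = ('C(n, 2)%:R - kappa * 'C(m, 2)%:R) * A (x ^+ 2)
    - kappa * ((n - m)%:R * m%:R) * (x * A x).
  rewrite coefB coefZ coefM !big_ord_recr big_ord0/= !c0 !c1 !c2.
  by rewrite !coef_affineX bin0 bin1; ring.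
have [nm|nm] := eqVneq (n%:R - kappa * m%:R : R) 0; last first.
  apply: derivation_of_bounded => //.
  exists (K * M / `|n%:R - kappa * m%:R|) => x x12.
  by rewrite ler_pdivlMr ?normr_gt0// mulrC -normrM -P1 Pb.
apply: derivation_of_square => //.
have bin2R k : 'C(k, 2)%:R = k%:R * (k%:R - 1) / 2 :> R.
  case: k => [|k]; first by rewrite bin0n mul0r mul0r.
  have /(congr1 (fun i => i%:R : R)) := mul_bin_diag k.+1 1.
  by rewrite bin1 !natrM -natr1 => ?; lra.
(* The coefficient of A (x^2) is C(n, 2) - kappa C(m, 2) = n (n - m) / 2,
   because kappa m = n. *)
have km : kappa * m%:R = n%:R by lra.
have nm0 : n%:R * (n%:R - m%:R) / 2 != 0 :> R.
  by rewrite !mulf_neq0 ?invr_eq0// ?pnatr_eq0 -?lt0n// subr_eq0 eqr_nat gtn_eqF.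
exists (K * M / `|n%:R * (n%:R - m%:R) / 2|) => x x12.
rewrite ler_pdivlMr ?normr_gt0// mulrC -normrM.
suff -> : n%:R * (n%:R - m%:R) / 2 * (A (x ^+ 2) - 2 * x * A x) = (P x)`_2.
  by rewrite Pb// (leq_ltn_trans m0).
rewrite P2 !bin2R (natrB _ (ltnW mn)).
have -> : n%:R * (n%:R - 1) / 2 - kappa * (m%:R * (m%:R - 1) / 2)
  = n%:R * (n%:R - 1) / 2 - (kappa * m%:R) * (m%:R - 1) / 2 :> R by ring.
have -> : kappa * ((n%:R - m%:R) * m%:R) = (kappa * m%:R) * (n%:R - m%:R) :> R.
  by ring.
by rewrite km; field.
Qed.

(** * Relations between opposite powers *)

(** Let [g] be the bounded error.  Applying [A] to the partial fraction identity
    [3 / (x (x + 3)) = 1 / x - 1 / (x + 3)] and replacing each [A (1/z)] by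
    [kappa A z / z^2 + g z / z], the terms with [A x] and [A (x^2)] combine into
    a multiple of [A (x^2) - 2 x A x].  The shift 3 keeps [x + 3] bounded and
    away from 0 on the whole annulus. *)
Lemma derivation_of_inversion (R : realType) (A : R -> R) (kappa : R) :
  additive_fun A -> A 1 = 0 -> kappa != 0 ->
  bounded_off0 (fun x => slope A x^-1 - kappa * slope A x) -> derivation A.
Proof.
move=> Aadd A1 kappa0 [C AC].
apply: derivation_of_square => //.
pose g x := slope A x^-1 - kappa * slope A x.
have E x : x != 0 -> x + 3 != 0 ->
    3 * kappa * (A (x ^+ 2) - 2 * x * A x) =
    x * (x + 3) * ((x + 3) * g x - x * g (x + 3) - 3 * g (x * (x + 3))).
  move=> x0 x30; rewrite /g.
  have A3 : A 3 = 0 by rewrite -[3]/(1 *+ 3) (additive_funMn _ _ Aadd) A1 mul0rn.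
  have e1 : A (x + 3) = A x by rewrite Aadd A3 addr0.
  have e2 : A (x * (x + 3)) = A (x ^+ 2) + 3 * A x.
    have -> : x * (x + 3) = x ^+ 2 + x *+ 3 by ring.
    by rewrite Aadd (additive_funMn _ _ Aadd) mulr_natl.
  have e3 : 3 * A (x * (x + 3))^-1 = A x^-1 - A (x + 3)^-1.
    rewrite mulr_natl -(additive_funMn _ _ Aadd) -(additive_funN _ Aadd) -Aadd.
    by congr A; field; rewrite x0 x30.
  rewrite /slope e1 e2 !invrK.
  have -> : A (x + 3)^-1 = A x^-1 - 3 * A (x * (x + 3))^-1 by rewrite e3; ring.
  by field; rewrite x0 x30.
(* On the annulus |x| <= 2 and |x + 3| <= 5; this bounds the right side of E. *)
exists (2 * 5 * (5 * `|C| + 2 * `|C| + 3 * `|C|) / (3 * `|kappa|)) => x.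
case/andP=> x1 x2.
have x0 : x != 0 by rewrite -normr_gt0 (lt_le_trans ltr01).
have x30 : x + 3 != 0.
  apply: contraTneq x2 => h; have -> : x = -3 by lra.
  by rewrite normrN normr_nat -ltNge ltr_nat.
have x5 : `|x + 3| <= 5.
  by rewrite (le_trans (ler_normD _ _))// normr_nat; lra.
have gC y : y != 0 -> `|g y| <= `|C|.
  by move=> y0; rewrite (le_trans (AC _ y0))// ler_norm.
rewrite ler_pdivlMr ?mulr_gt0 ?normr_gt0//.
rewrite -[3 * `|kappa|](ger0_norm (_ : 0 <= _)) ?mulr_ge0// mulrC -normrM.
have -> : `|3 * `|kappa| * (A (x ^+ 2) - 2 * x * A x)|
    = `|3 * kappa * (A (x ^+ 2) - 2 * x * A x)|.
  by rewrite !normrM normr_id.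
rewrite E// 2!normrM ler_pM ?mulr_ge0 ?ler_pM//.
rewrite (le_trans (ler_normB _ _))// lerD//; last first.
  by rewrite normrM [`|3|]ger0_norm// ler_wpM2l// gC// mulf_neq0.
rewrite (le_trans (ler_normB _ _))// lerD//.
  by rewrite normrM ler_pM// gC.
by rewrite normrM ler_pM// gC.
Qed.

(** * Reduction of arbitrary exponents *)

Lemma exprn_root (R : realType) (n : nat) (y : R) :
  (0 < n)%N -> 0 < y -> exists2 x : R, 0 < x & x ^+ n = y.
Proof.
move=> n0 y0; pose p : {poly R} := 'X^n - y%:P.
have [||x /andP[x0 _]] := @poly_ivt R p 0 (1 + y).
- by rewrite addr_ge0// ltW.
- rewrite !hornerE expr0n eqn0Ngt n0 sub0r oppr_le0 ltW//= subr_ge0.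
  rewrite -[leLHS]expr1 (@le_trans _ _ ((1 + y) ^+ 1))//.
    by rewrite !expr1 lerDr.
  by rewrite ler_weXn2l// lerDl ltW.
rewrite /root !hornerE subr_eq0 => /eqP xn; exists x => //.
rewrite lt_neqAle x0 andbT; apply: contraTneq y0 => x00.
by rewrite -xn -x00 expr0n eqn0Ngt n0 ltxx.
Qed.

Lemma exprz_root (R : realType) (n : int) (y : R) :
  n != 0 -> 0 < y -> exists2 x : R, x != 0 & x ^ n = y.
Proof.
case: n => n n0 y0.
  have n_gt0 : (0 < n)%N by rewrite lt0n.
  have [x x0 <-] := exprn_root n_gt0 y0.
  by exists x; rewrite ?gt_eqF.
have y0' : 0 < y^-1 by rewrite invr_gt0.
have [x x0 xy] := exprn_root (ltn0Sn n) y0'.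
by exists x; rewrite ?gt_eqF// NegzE -exprnN xy invrK.
Qed.

(** Real roots settle [kappa = 0] and [m = - n].  In the remaining case the
    two substitutions [x ^ n] and [x ^ m] share the middle term [x ^ (n m)], and
    eliminating it leaves the positive exponents [n^2] and [m^2], which differ
    because [|n| <> |m|].  If [n^2 < m^2], dividing by [kappa^2] exchanges their
    roles. *)
Lemma derivation_of_power_relation (R : realType) (A : R -> R) (kappa : R)
    (n m : int) :
  additive_fun A -> A 1 = 0 -> n != 0 -> m != 0 -> n != m ->
  bounded_off0 (fun x => slope A (x ^ n) - kappa * slope A (x ^ m)) ->
  derivation A.
Proof.
move=> Aadd A1 n0 m0 nm [C AC].
have [k0|k0] := eqVneq kappa 0.
  apply: derivation_of_bounded => //; exists (C * 2) => y /andP[y1 y2].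
  have y_gt0 : 0 < `|y| by rewrite (lt_le_trans ltr01).
  have [x x0 xn] := exprz_root n0 y_gt0.
  have := AC x x0; rewrite k0 mul0r subr0 xn slope_norm// => yC.
  have C0 : 0 <= C by rewrite (le_trans _ yC).
  move: yC; rewrite normrM normfV ler_pdivrMr// => /le_trans; apply.
  by rewrite ler_wpM2l.
have [/eqP|nm'] := eqVneq `|n|%N `|m|%N.
  rewrite -eqz_nat !abszE eqr_norm2 => /orP[/eqP nmE|/eqP nmE].
    by rewrite nmE eqxx in nm.
  apply: (@derivation_of_inversion _ _ kappa) => //.
  exists C => y y0; have y_gt0 : 0 < `|y| by rewrite normr_gt0.
  have [x x0 xm] := exprz_root m0 y_gt0.
  have := AC x x0; rewrite nmE -invr_expz xm slope_norm//.
  by rewrite -normfV slope_norm.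
have sqE (k : int) : (`|k| * `|k|)%N = k * k :> int.
  by rewrite PoszM abszE -normrM ger0_norm// -expr2 sqr_ge0.
have B x : x != 0 -> `|slope A (x ^+ (`|n| * `|n|)) -
    kappa ^+ 2 * slope A (x ^+ (`|m| * `|m|))| <= C + `|kappa| * C.
  move=> x0; have := AC _ (expfz_neq0 m x0); have := AC _ (expfz_neq0 n x0).
  rewrite !exprz_exp [m * n]mulrC -!sqE => h1 h2.
  have -> : slope A (x ^+ (`|n| * `|n|)) - kappa ^+ 2 * slope A (x ^+ (`|m| * `|m|))
    = (slope A (x ^ (`|n| * `|n|)%N) - kappa * slope A (x ^ (n * m)))
     + kappa * (slope A (x ^ (n * m)) - kappa * slope A (x ^ (`|m| * `|m|)%N)).
    by ring.
  by rewrite (le_trans (ler_normD _ _))// lerD// normrM ler_wpM2l.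
have [lt_mn|le_nm] := ltnP `|m| `|n|.
  apply: (@derivation_of_lt_exponents _ _ (kappa ^+ 2)
    (`|n| * `|n|) (`|m| * `|m|)) => //.
    by rewrite muln_gt0 !absz_gt0 m0/= ltn_mul.
  by exists (C + `|kappa| * C).
have lt_nm : (`|n| < `|m|)%N by rewrite ltn_neqAle nm'.
apply: (@derivation_of_lt_exponents _ _ (kappa ^- 2)
  (`|m| * `|m|) (`|n| * `|n|)) => //.
  by rewrite muln_gt0 !absz_gt0 n0/= ltn_mul.
exists (`|kappa ^- 2| * (C + `|kappa| * C)) => x x0.
set a := slope A _; set b := slope A _.
have -> : a - kappa ^- 2 * b = - kappa ^- 2 * (b - kappa ^+ 2 * a).
  by field.
by rewrite normrM normrN ler_wpM2l// B.
Qed.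

(** * Transfer from the approximate to the additive function *)

Lemma annulus_exprz (R : realType) (n : int) (x : R) :
  1 <= `|x| <= 2 -> `|x ^ n|^-1 <= 2 ^+ `|n|.
Proof.
case/andP=> x1 x2; have x_gt0 : 0 < `|x| by rewrite (lt_le_trans ltr01).
case: n => n.
  rewrite normrX (@le_trans _ _ 1) ?exprn_ege1 ?ler1n// invf_le1 ?exprn_gt0//.
  by rewrite exprn_ege1.
by rewrite NegzE -exprnN normfV invrK normrX abszN lerXn2r ?nnegrE.
Qed.

(** On the annulus all powers of [x] that occur are bounded, so the errors
    [f - A], at most [e1], stay bounded after division by [x ^ n] and [x ^ m];
    outside the annulus they need not, which is where homogeneity is used. *)
Lemma slope_relation_bounded (R : realType) (f A : R -> R) (e1 e2 kappa : R)
    (n m : int) :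
  additive_fun A -> (forall x, `|f x - A x| <= e1) ->
  (forall x, x != 0 -> `|f (x ^ n) - kappa * x ^ (n - m) * f (x ^ m)| <= e2) ->
  bounded_off0 (fun x => slope A (x ^ n) - kappa * slope A (x ^ m)).
Proof.
move=> Aadd fA fe.
apply: homogeneous_bounded => [q x q0|].
  have [->|x0] := eqVneq x 0; first by rewrite mulr0.
  have qz (k : int) : (ratr q * x) ^ k = ratr (q ^ k) * x ^ k.
    by rewrite exprzMl ?unitfE ?fmorph_eq0// fmorphXz.
  by rewrite !qz !slope_homogeneous// expfz_neq0.
exists (e2 * 2 ^+ `|n| + e1 * 2 ^+ `|n| + `|kappa| * (e1 * 2 ^+ `|m|)) => x x12.
have x0 : x != 0 by rewrite -normr_gt0 (lt_le_trans ltr01)//; case/andP: x12.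
have -> : slope A (x ^ n) - kappa * slope A (x ^ m) =
    (f (x ^ n) - kappa * x ^ (n - m) * f (x ^ m)) * (x ^ n)^-1
    - (f (x ^ n) - A (x ^ n)) * (x ^ n)^-1
    + kappa * ((f (x ^ m) - A (x ^ m)) * (x ^ m)^-1).
  rewrite /slope; move: (f _) (A _) (f _) (A _) => a b c d.
  by rewrite expfzDr// -invr_expz; field; rewrite !expfz_neq0.
have pM u (k : int) (c : R) :
    `|u| <= c -> `|u * (x ^ k)^-1| <= c * 2 ^+ `|k|.
  by move=> uc; rewrite normrM normfV ler_pM ?invr_ge0// annulus_exprz.
rewrite (le_trans (ler_normD _ _))// lerD ?normrM ?ler_wpM2l -?normrM ?pM//.
by rewrite (le_trans (ler_normB _ _))// lerD ?pM// fe.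
Qed.

Theorem theorem3p2 (R : realType) (eps1 eps2 kappa : R) (n m : int)
    (f : R -> R) :
  0 <= eps1 -> 0 <= eps2 ->
  n != 0 -> m != 0 -> n != m ->
  (forall x y : R, `|f (x + y) - f x - f y| <= eps1) ->
  (forall x : R, x != 0 ->
     `|f (x ^ n) - kappa * x ^ (n - m) * f (x ^ m)| <= eps2) ->
  exists (F : R -> R) (lambda : R),
    derivation F /\
    forall x : R,
      (n%:~R - kappa * m%:~R) * F x = 0 /\
      `|f x - (F x + lambda * x)| <= eps1.
Proof.
move=> _ _ n0 m0 nm fadd fpow.
have [A [Aadd fA]] := hyers fadd.
have [C AC] := slope_relation_bounded Aadd fA fpow.
pose F x := A x - A 1 * x.
have Fadd : additive_fun F by move=> x y; rewrite /F Aadd; ring.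
have F1 : F 1 = 0 by rewrite /F; ring.
have FC x : x != 0 -> `|slope F (x ^ n) - kappa * slope F (x ^ m)|
    <= C + `|A 1 * (1 - kappa)|.
  move=> x0; have -> : slope F (x ^ n) - kappa * slope F (x ^ m) =
      slope A (x ^ n) - kappa * slope A (x ^ m) - A 1 * (1 - kappa).
    rewrite /slope /F; move: (A (_ ^ _)) (A (_ ^ _)) => a b.
    by field; rewrite !expfz_neq0.
  by rewrite (le_trans (ler_normB _ _))// lerD2r AC.
have Fder : derivation F.
  apply: (@derivation_of_power_relation _ _ kappa n m) => //.
  by exists (C + `|A 1 * (1 - kappa)|).
exists F, (A 1); split=> // x; split; last first.
  by have -> : F x + A 1 * x = A x by rewrite /F; ring.
pose G y := (n%:~R - kappa * m%:~R) * F y.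
have Gadd : additive_fun G by move=> y z; rewrite /G Fadd; ring.
suff GB : bounded_annulus G.
  by have := additive_bounded_linear Gadd GB x; rewrite {2}/G F1 mulr0 mul0r.
exists ((C + `|A 1 * (1 - kappa)|) * 2) => y /andP[y1 y2].
have y_gt0 : 0 < `|y| by rewrite (lt_le_trans ltr01).
have y0 : y != 0 by rewrite -normr_gt0.
have := FC y y0; rewrite !derivation_slope_exprz// => yC.
have -> : G y = (n%:~R * slope F y - kappa * (m%:~R * slope F y)) * y.
  by rewrite /G /slope; field.
by rewrite normrM ler_pM.
Qed.
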